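(* Let $n,m\ge 1$, let $\mathcal{E}\subset\{1,\dots,m\}\times\{1,\dots,m\}$ be the edge set of a connected undirected graph on the vertex set $\{1,\dots,m\}$ (so $(i,j)\in\mathcal{E}$ implies $(j,i)\in\mathcal{E}$), and for each $(i,j)\in\mathcal{E}$ let $\mathbf{P}_{ij}\in\mathcal{P}_n$ be a given permutation matrix, with $\mathbf{P}_{ji}=\mathbf{P}_{ij}^{-1}$ and $\mathbf{P}_{ii}=\mathbf{I}$. Let $\mathbf{Q}'\in\mathbb{R}^{mn^2\times mn^2}$ be the block matrix $$\mathbf{Q}'=-\begin{bmatrix}\mathbf{I}\otimes\mathbf{P}_{11}&\mathbf{I}\otimes\mathbf{P}_{12}&\cdots&\mathbf{I}\otimes\mathbf{P}_{1m}\\ \mathbf{I}\otimes\mathbf{P}_{21}&\mathbf{I}\otimes\mathbf{P}_{22}&\cdots&\mathbf{I}\otimes\mathbf{P}_{2m}\\ \vdots&\vdots&\ddots&\vdots\\ \mathbf{I}\otimes\mathbf{P}_{m1}&\mathbf{I}\otimes\mathbf{P}_{m2}&\cdots&\mathbf{I}\otimes\mathbf{P}_{mm}\end{bmatrix},$$ where $\mathbf{I}$ is the $n\times n$ identity matrix, $\mathbf{P}_{ii}:=\mathbf{I}$ for every $i$, and $\mathbf{P}_{ij}:=\mathbf{0}$ for $i\neq j$ with $(i,j)\notin\mathcal{E}$. For $\mathbf{X}_1,\dots,\mathbf{X}_m\in\mathcal{P}_n$ put $\mathbf{x}_i=\mathrm{vec}(\mathbf{X}_i)\in\{0,1\}^{n^2}$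 and $\mathbf{x}=[\mathbf{x}_1^\top\ \cdots\ \mathbf{x}_m^\top]^\top$. Then the two minimization problems over tuples $(\mathbf{X}_1,\dots,\mathbf{X}_m)\in\mathcal{P}_n^m$ have the same set of minimizers: $$\arg\min_{\{\mathbf{X}_i\in\mathcal{P}_n\}}\ \sum_{(i,j)\in\mathcal{E}}\|\mathbf{P}_{ij}-\mathbf{X}_i\mathbf{X}_j^\top\|_{\mathrm{F}}^2\;=\;\arg\min_{\{\mathbf{X}_i\in\mathcal{P}_n\}}\ \mathbf{x}^\top\mathbf{Q}'\mathbf{x}.$$
   Context: $\mathcal{P}_n=\{\mathbf{P}\in\{0,1\}^{n\times n}:\mathbf{P}\mathbf{1}_n=\mathbf{1}_n,\ \mathbf{1}_n^\top\mathbf{P}=\mathbf{1}_n^\top\}$ is the set of $n\times n$ permutation matrices, where $\mathbf{1}_n$ is the all-ones vector of length $n$; $\mathcal{P}_n^m$ is the set of $m$-tuples of such matrices. $\|\cdot\|_{\mathrm{F}}$ is the Frobenius norm, $\otimes$ is the Kronecker product, and $\mathrm{vec}$ stacks the columns of a matrix into one column vector. $\arg\min$ denotes the set of all minimizers. *)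

(* Defs.v *)
From HB Require Import structures.
From mathcomp Require Import all_boot all_order all_algebra.
From mathcomp Require Import boolp classical_sets reals.
From mathcomp Require Import mxtens.

Set Implicit Arguments.
Unset Strict Implicit.
Unset Printing Implicit Defensive.

Import Order.TTheory GRing.Theory Num.Theory.
Local Open Scope ring_scope.
Local Open Scope classical_set_scope.

Definition permutation_matrices (R : realType) (n : nat) : set 'M[R]_n :=
  [set P : 'M[R]_n | [/\ forall i j, P i j = 0 \/ P i j = 1,
               P *m (const_mx 1 : 'cV[R]_n) = const_mx 1
             & (const_mx 1 : 'cV[R]_n)^T *m P = (const_mx 1 : 'cV[R]_n)^T]].
Arguments permutation_matrices : clear implicits.

Definition permutation_tuples (R : realType) (n m : nat) :
    set ('I_m -> 'M[R]_n) :=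
  [set X : 'I_m -> 'M[R]_n | forall i, permutation_matrices R n (X i)].
Arguments permutation_tuples : clear implicits.

Definition frobenius_norm (R : realType) (p q : nat) (A : 'M[R]_(p, q)) : R :=
  Num.sqrt (\sum_i \sum_j A i j ^+ 2).

(* The entry A i j of a p x q matrix sits at position j * p + i (columns are
   stacked), the same indexing of 'I_(q * p) as used by the Kronecker product
   tensmx; mathcomp's mxvec stacks rows instead. *)
Definition vec (R : realType) (p q : nat) (A : 'M[R]_(p, q)) : 'cV[R]_(q * p) :=
  \col_k A (mxtens_unindex k).2 (mxtens_unindex k).1.

Definition argmin (R : realType) (T : Type) (D : set T) (f : T -> R) : set T :=
  [set x | D x /\ forall y, D y -> f x <= f y].

(* The set E of ordered pairs is the edge set of an undirected connected graph
   on 'I_m; loops are allowed. *)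
Definition connected_graph (m : nat) (E : {set 'I_m * 'I_m}) : Prop :=
  (forall i j, (i, j) \in E -> (j, i) \in E) /\
  (forall i j, connect [rel u v | (u, v) \in E] i j).

(* P is only meaningful on E: the diagonal blocks are the identity, and the
   blocks off the diagonal and outside E vanish. *)
Definition extend_blocks (R : realType) (n m : nat) (E : {set 'I_m * 'I_m})
    (P : 'I_m -> 'I_m -> 'M[R]_n) (i j : 'I_m) : 'M[R]_n :=
  if i == j then 1%:M else if (i, j) \in E then P i j else 0.

Definition Qmat (R : realType) (n m : nat) (E : {set 'I_m * 'I_m})
    (P : 'I_m -> 'I_m -> 'M[R]_n) :
    'M[R]_((\sum_(i < m) n * n)%N, (\sum_(i < m) n * n)%N) :=
  - \mxblock_(i < m, j < m) ((1%:M : 'M[R]_n) *t extend_blocks E P i j).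

Definition stacked_vec (R : realType) (n m : nat) (X : 'I_m -> 'M[R]_n) :
    'cV[R]_((\sum_(i < m) n * n)%N) :=
  \mxcol_(i < m) vec (X i).

Definition sync_objective (R : realType) (n m : nat) (E : {set 'I_m * 'I_m})
    (P : 'I_m -> 'I_m -> 'M[R]_n) (X : 'I_m -> 'M[R]_n) : R :=
  \sum_(e in E) frobenius_norm (P e.1 e.2 - X e.1 *m (X e.2)^T) ^+ 2.

(* The 1 x 1 matrix x^T Q' x, read as a scalar. *)
Definition quad_objective (R : realType) (n m : nat) (E : {set 'I_m * 'I_m})
    (P : 'I_m -> 'I_m -> 'M[R]_n) (X : 'I_m -> 'M[R]_n) : R :=
  ((stacked_vec X)^T *m Qmat E P *m stacked_vec X) 0 0.

(* Main.v *)
Require Import Defs.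
From mathcomp Require Import all_boot all_order all_algebra.
From mathcomp Require Import boolp classical_sets reals.
From mathcomp Require Import mxtens ring lra.

(** Permutation matrices are orthogonal, so expanding the squared Frobenius
    norm gives [|P_ij - X_i X_j^T|^2 = 2 n - 2 tr (X_i^T P_ij X_j)], while
    [x_i^T (I (x) P_ij) x_j = tr (X_i^T P_ij X_j)].  The diagonal blocks of
    [Q'] contribute only constants, hence the first objective is twice the
    second one plus a constant. *)

Set Implicit Arguments.
Unset Strict Implicit.
Unset Printing Implicit Defensive.

Import Order.TTheory GRing.Theory Num.Theory.
Local Open Scope ring_scope.
Local Open Scope classical_set_scope.

Lemma argmin_affine (R : realType) (T : Type) (D : set T) (f g : T -> R)
    (a b : R) :
  0 < a -> (forall x, D x -> f x = a * g x + b) -> argmin D f = argmin D g.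
Proof.
move=> a0 fg; apply/seteqP; split=> x /= [Dx minx]; split=> // y Dy.
  by move: (minx y Dy); rewrite !fg // lerD2r ler_pM2l.
by rewrite !fg // lerD2r ler_pM2l // minx.
Qed.

Lemma sum_mxtens_unindex (R : nmodType) (m n : nat) (F : 'I_m * 'I_n -> R) :
  \sum_(k < m * n) F (mxtens_unindex k) = \sum_i \sum_j F (i, j).
Proof.
rewrite pair_bigA [RHS](reindex (@mxtens_unindex m n)).
  exact: eq_bigr.
by exists (@mxtens_index m n) => i _; rewrite (mxtens_indexK, mxtens_unindexK).
Qed.

Lemma frobenius_norm_sqr (R : realType) (p q : nat) (A : 'M[R]_(p, q)) :
  frobenius_norm A ^+ 2 = \tr (A^T *m A).
Proof.
rewrite sqr_sqrtr; last by do 2 (apply: sumr_ge0 => ? _); exact: sqr_ge0.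
rewrite exchange_big; apply: eq_bigr => j _; rewrite mxE.
by apply: eq_bigr => i _; rewrite !mxE expr2.
Qed.

Lemma frobenius_norm_sqrB (R : realType) (p q : nat) (A B : 'M[R]_(p, q)) :
  frobenius_norm (A - B) ^+ 2 =
  \tr (A^T *m A) + \tr (B^T *m B) - 2 * \tr (B^T *m A).
Proof.
rewrite frobenius_norm_sqr [(A - B)^T]linearB /= mulmxBl !mulmxBr !linearB /=.
(* The two cross terms are traces of mutually transposed matrices, hence equal. *)
by rewrite -[\tr (A^T *m B)]mxtrace_tr trmx_mul trmxK; ring.
Qed.

Lemma vec_inner (R : realType) (p q : nat) (A B : 'M[R]_(p, q)) :
  ((vec A)^T *m vec B) 0 0 = \tr (A^T *m B).
Proof.
rewrite mxE (eq_bigr (fun k => A (mxtens_unindex k).2 (mxtens_unindex k).1 *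
   B (mxtens_unindex k).2 (mxtens_unindex k).1)); last by move=> k _; rewrite !mxE.
rewrite (sum_mxtens_unindex (fun k => A k.2 k.1 * B k.2 k.1)).
by apply: eq_bigr => j _; rewrite mxE; apply: eq_bigr => i _; rewrite mxE.
Qed.

(** With column stacking, the identity factor is a Kronecker delta on column indices, so [B] acts on
    each column of [A] separately. *)
Lemma tens1mx_vec (R : realType) (p q r : nat) (B : 'M[R]_(r, p))
    (A : 'M[R]_(p, q)) :
  ((1%:M : 'M[R]_q) *t B) *m vec A = vec (B *m A).
Proof.
apply/colP => k; rewrite !mxE; set i := (mxtens_unindex k).2.
set j := (mxtens_unindex k).1.
rewrite (eq_bigr (fun l => (j == (mxtens_unindex l).1)%:R *
   (B i (mxtens_unindex l).2 * A (mxtens_unindex l).2 (mxtens_unindex l).1)));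
  last by move=> l _; rewrite !mxE mulrA.
rewrite (sum_mxtens_unindex (fun l => (j == l.1)%:R * (B i l.2 * A l.2 l.1))).
rewrite (bigD1 j) //= [X in _ + X]big1 ?addr0 => [|l /negPf lj].
  by apply: eq_bigr => l _; rewrite eqxx mul1r.
by apply: big1 => h _; rewrite eq_sym lj mul0r.
Qed.

(** Diagonal entries of [X^T *m X] are column sums, since 0 and 1 are idempotent; the others vanish
    because no row holds two ones. *)
Lemma permutation_matrix_orthogonal (R : realType) (n : nat) (X : 'M[R]_n) :
  permutation_matrices R n X -> X^T *m X = 1%:M.
Proof.
move=> [X01 /matrixP rowX /matrixP colX].
have Xge0 i j : 0 <= X i j by case: (X01 i j) => ->.
have rowsum i : \sum_j X i j = 1.
  move: (rowX i 0); rewrite !mxE => <-.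
  by apply: eq_bigr => j _; rewrite mxE mulr1.
have colsum j : \sum_i X i j = 1.
  move: (colX 0 j); rewrite !mxE => <-.
  by apply: eq_bigr => i _; rewrite !mxE mul1r.
apply/matrixP => i j; rewrite !mxE; case: (eqVneq i j) => [<-|ij].
  rewrite -[RHS](colsum i); apply: eq_bigr => k _; rewrite mxE.
  by case: (X01 k i) => ->; rewrite ?mulr0 ?mulr1.
apply: big1 => k _; rewrite mxE.
case: (X01 k i) => [->|Xki]; first by rewrite mul0r.
case: (X01 k j) => [->|Xkj]; first by rewrite mulr0.
(* Two ones and nonnegative remaining entries would force the sum of row [k] to be at least 2. *)
have := rowsum k; rewrite (bigD1 i) //= (bigD1 j) 1?eq_sym //= Xki Xkj.
have : 0 <= \sum_(l < n | (l != i) && (l != j)) X k l by apply: sumr_ge0.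
by move=> *; exfalso; lra.
Qed.

Lemma sync_objective_trace (R : realType) (n m : nat)
    (E : {set 'I_m * 'I_m}) (P : 'I_m -> 'I_m -> 'M[R]_n)
    (X : 'I_m -> 'M[R]_n) :
  (forall i j, (i, j) \in E -> permutation_matrices R n (P i j)) ->
  permutation_tuples R n m X ->
  sync_objective E P X =
  \sum_(e in E) (2 * n%:R - 2 * \tr ((X e.1)^T *m P e.1 e.2 *m X e.2)).
Proof.
move=> hperm hX; apply: eq_bigr => -[i j] /= /hperm Pij.
rewrite frobenius_norm_sqrB trmx_mul trmxK.
rewrite (permutation_matrix_orthogonal Pij) mxtrace1.
have -> : X j *m (X i)^T *m (X i *m (X j)^T) = X j *m (X j)^T.
  rewrite mulmxA -(mulmxA (X j)) (permutation_matrix_orthogonal (hX i)).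
  by rewrite mulmx1.
(* Cyclicity of the trace turns [X j *m (X j)^T] into the product covered by orthogonality; on the
   next line it moves [X j] to the end of the cross term. *)
rewrite mxtrace_mulC (permutation_matrix_orthogonal (hX j)) mxtrace1.
by rewrite -(mulmxA (X j)) mxtrace_mulC; ring.
Qed.

Lemma quad_objective_trace (R : realType) (n m : nat)
    (E : {set 'I_m * 'I_m}) (P : 'I_m -> 'I_m -> 'M[R]_n)
    (X : 'I_m -> 'M[R]_n) :
  quad_objective E P X =
  - \sum_i \sum_j \tr ((X i)^T *m extend_blocks E P i j *m X j).
Proof.
rewrite /quad_objective /Qmat /stacked_vec mulmxN mulNmx mxE.
rewrite -mulmxA mul_mxblock_mxrow tr_mxcol mul_mxrow_mxcol summxE.
congr (- _); apply: eq_bigr => i _; rewrite mulmx_sumr summxE.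
by apply: eq_bigr => j _; rewrite tens1mx_vec vec_inner mulmxA.
Qed.

Theorem proposition1 (R : realType) (n m : nat) (hn : (1 <= n)%N)
    (hm : (1 <= m)%N) (E : {set 'I_m * 'I_m}) (hE : connected_graph E)
    (P : 'I_m -> 'I_m -> 'M[R]_n)
    (hperm : forall i j, (i, j) \in E -> permutation_matrices R n (P i j))
    (hinv : forall i j, (i, j) \in E -> P j i = invmx (P i j))
    (hdiag : forall i, (i, i) \in E -> P i i = 1%:M) :
  argmin (permutation_tuples R n m) (sync_objective E P) =
  argmin (permutation_tuples R n m) (quad_objective E P).
Proof.
(* [extend_blocks] puts the identity on the diagonal also when the loop
   [(i, i)] is not an edge; each such [i] contributes [n]. *)
pose c : R := \sum_(e | (e \notin E) && (e.1 == e.2)) n%:R.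
(* The slope 2 is the factor of the cross term; the offset collects [2 * n%:R] per edge and
   compensates the constant [c] contained in the negated quadratic form. *)
apply: (@argmin_affine _ _ _ _ _ 2 (\sum_(e in E) 2 * n%:R + 2 * c)) => // X hX.
rewrite sync_objective_trace // quad_objective_trace pair_bigA /=.
rewrite [X in - X](bigID (mem E)) /=.
(* On edges the extended block is [P] itself; for loops this is [hdiag]. *)
rewrite [X in - (X + _)](eq_bigr
    (fun e => \tr ((X e.1)^T *m P e.1 e.2 *m X e.2))); last first.
  move=> [i j] /= ijE; rewrite /extend_blocks ijE.
  by case: eqVneq ijE => // <- /hdiag ->.
(* Outside [E] only diagonal blocks survive, and there orthogonality of [X i] makes the trace
   independent of [X]. *)
have -> : \sum_(e | e \notin E)
    \tr ((X e.1)^T *m extend_blocks E P e.1 e.2 *m X e.2) = c.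
  rewrite /c [RHS]big_mkcondr; apply: eq_bigr => -[i j] /= /negPf ijE.
  rewrite /extend_blocks ijE; case: eqVneq => [<-|_].
    by rewrite mulmx1 (permutation_matrix_orthogonal (hX i)) mxtrace1.
  by rewrite mulmx0 mul0mx mxtrace0.
by rewrite sumrB -!mulr_sumr; ring.
Qed.
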